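(* Let $\mathcal{R}$ be a commutative ring with unity, let $\mathcal{A}$ be an $\mathcal{R}$-algebra, and let $B_n^{\bar{k}}(\mathcal{A})$ ($n\geq 1$) be a block upper triangular matrix algebra, where $\bar{k}=(k_1,\dots,k_m)\in\mathbb{N}^m$ with $k_1+\cdots+k_m=n$. Then: (i) If $k_m\geq 2$, then $B_n^{\bar{k}}(\mathcal{A})$ ($n\geq 2$) is a SLIP algebra. (ii) If $k_m=1$, then $B_n^{\bar{k}}(\mathcal{A})$ is a SLIP algebra if and only if $\mathcal{A}$ is a SLIP algebra.
   Context: All algebras are associative $\mathcal{R}$-algebras with unity $1$; $\mathbb{N}$ is the set of positive integers. For $m\le n$ and $\bar{k}=(k_1,\dots,k_m)\in\mathbb{N}^m$ with $n=k_1+\cdots+k_m$, the block upper triangular matrix algebra $B_n^{\bar{k}}(\mathcal{A})$ is the subalgebra of the matrix algebra $M_n(\mathcal{A})$ consisting of block matrices whose $(i,j)$-block is an arbitrary element of $M_{k_i\times k_j}(\mathcal{A})$ if $i\le j$ and is $0$ if $i>j$ ($1\le i,j\le m$). For an algebra $\mathcal{C}$, an $\mathcal{R}$-linear map $\psi:\mathcal{C}\to\mathcal{C}$ is a left multiplier if $\psi(c)=\psi(1)c$ for all $c\in\mathcal{C}$; it is LIP (left-ideal-preserving) if $\psi(\mathcal{J})\subseteq\mathcal{J}$ for every left ideal $\mathcal{J}$ of $\mathcal{C}$. The algebra $\mathcal{C}$ is SLIP if every LIP map on $\mathcal{C}$ is a left multiplier. *)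

(* Defs.v *)
From HB Require Import structures.
From mathcomp Require Import all_boot all_order all_algebra.

Set Implicit Arguments.
Unset Strict Implicit.
Unset Printing Implicit Defensive.

Import GRing.Theory.
Local Open Scope ring_scope.

Section SLIP.
Variables (R : pzRingType) (C : algType R).

(* Closure under scaling by R is automatic: r *: x = (r *: 1) * x. *)
Definition left_ideal (J : C -> Prop) : Prop :=
  [/\ J 0, forall x y, J x -> J y -> J (x + y)
    & forall c x, J x -> J (c * x)].

Definition left_multiplier (psi : C -> C) : Prop :=
  forall c, psi c = psi 1 * c.

Definition LIP (psi : C -> C) : Prop :=
  forall J, left_ideal J -> forall x, J x -> J (psi x).

Definition SLIP : Prop :=
  forall psi : {linear C -> C}, LIP psi -> left_multiplier psi.

End SLIP.

Arguments SLIP {R} C.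

Section BlockTriangular.
Variables (R : pzRingType) (A : algType R) (m : nat) (k : 'I_m.+1 -> nat).

Definition block_utrig : {pred 'M[A]_(\sum_i k i)} :=
  fun M => [forall i : 'I_m.+1, forall j : 'I_m.+1, (j < i)%N ==> (submxblock M i j == 0)].

Lemma block_utrigP (M : 'M[A]_(\sum_i k i)) :
  reflect (forall i j : 'I_m.+1, (j < i)%N -> submxblock M i j = 0)
          (M \in block_utrig).
Proof.
apply: (iffP forallP) => [h i j lt_ji | h i].
  by apply/eqP; move: (h i) => /forallP/(_ j)/implyP; apply.
by apply/forallP => j; apply/implyP => lt_ji; apply/eqP/h.
Qed.

Lemma submxblock_mul (M N : 'M[A]_(\sum_i k i)) i j :
  submxblock (M *m N) i j = \sum_l submxblock M i l *m submxblock N l j.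
Proof.
by rewrite -[M in LHS]submxblockK -[N in LHS]submxblockK mul_mxblock mxblockK.
Qed.

Lemma submxblock1 i j :
  i != j -> submxblock (1%:M : 'M[A]_(\sum_i k i)) i j = 0.
Proof.
move=> neq_ij; apply/matrixP => a b; rewrite !mxE.
case: eqP => // /(congr1 tagnat.sig1); rewrite !tagnat.Rank1K => eq_ij.
by rewrite eq_ij eqxx in neq_ij.
Qed.

Fact block_utrig_subring : subring_closed block_utrig.
Proof.
split=> [|M N /block_utrigP hM /block_utrigP hN
         |M N /block_utrigP hM /block_utrigP hN]; apply/block_utrigP => i j lt_ji.
- by rewrite submxblock1 // -val_eqE /= gtn_eqF.
- by rewrite submxblockB hM // hN // subr0.
rewrite submxblock_mul big1 // => l _.
have [lt_li|le_il] := ltnP l i; first by rewrite hM // mul0mx.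
by rewrite hN ?mulmx0 // (leq_trans lt_ji).
Qed.

HB.instance Definition _ :=
  GRing.isSubringClosed.Build 'M[A]_(\sum_i k i) block_utrig block_utrig_subring.

(* Positivity of the block sizes is a parameter of the type because [algType]
   requires 1 != 0. *)
Record btmx (k_gt0 : forall i, (0 < k i)%N) := BTMx {
  btmx_val :> 'M[A]_(\sum_i k i);
  _ : btmx_val \in block_utrig
}.

Section Algebra.
Variable k_gt0 : forall i, (0 < k i)%N.
Local Notation btmx := (btmx k_gt0).

HB.instance Definition _ := [isSub for @btmx_val k_gt0].
HB.instance Definition _ := [Choice of btmx by <:].
HB.instance Definition _ :=
  GRing.SubChoice_isSubPzRing.Build _ _ btmx block_utrig_subring.

Fact btmx_oner_neq0 : (1 : btmx) != 0.
Proof.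
have n_gt0 : (0 < \sum_i k i)%N by rewrite (bigD1 ord0) //= addn_gt0 k_gt0.
apply/eqP => /(congr1 val)/matrixP/(_ (Ordinal n_gt0) (Ordinal n_gt0))/eqP.
by rewrite !mxE eqxx oner_eq0.
Qed.

HB.instance Definition _ :=
  GRing.PzSemiRing_isNonZero.Build btmx btmx_oner_neq0.

(* R acts entrywise; the library's scaling on 'M[A]_n is by A, not by R. *)
Fact btmx_scale_subproof (r : R) (M : btmx) :
  map_mx (fun a : A => r *: a) M \in block_utrig.
Proof.
apply/block_utrigP => i j lt_ji; apply/matrixP => a b.
have /block_utrigP/(_ i j lt_ji)/matrixP/(_ a b) := valP M.
by rewrite !mxE => ->; rewrite scaler0.
Qed.

Definition btmx_scale r M := @BTMx k_gt0 _ (btmx_scale_subproof r M).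

Fact btmx_scalerA a b M :
  btmx_scale a (btmx_scale b M) = btmx_scale (a * b) M.
Proof. by apply/val_inj/matrixP => i j; rewrite !mxE scalerA. Qed.

Fact btmx_scale1r : left_id 1 btmx_scale.
Proof. by move=> M; apply/val_inj/matrixP => i j; rewrite !mxE scale1r. Qed.

Fact btmx_scalerDr : right_distributive btmx_scale +%R.
Proof. by move=> a M N; apply/val_inj/matrixP => i j; rewrite !mxE scalerDr. Qed.

Fact btmx_scalerDl M : {morph btmx_scale^~ M : a b / a + b}.
Proof. by move=> a b; apply/val_inj/matrixP => i j; rewrite !mxE scalerDl. Qed.

HB.instance Definition _ := GRing.Zmodule_isLmodule.Build R btmx
  btmx_scalerA btmx_scale1r btmx_scalerDr btmx_scalerDl.

Fact btmx_scalerAl (r : R) (M N : btmx) : r *: (M * N) = (r *: M) * N.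
Proof.
apply/val_inj/matrixP => i j; rewrite !mxE scaler_sumr.
by apply: eq_bigr => l _; rewrite !mxE scalerAl.
Qed.

HB.instance Definition _ := GRing.Lmodule_isLalgebra.Build R btmx btmx_scalerAl.

Fact btmx_scalerAr (r : R) (M N : btmx) : r *: (M * N) = M * (r *: N).
Proof.
apply/val_inj/matrixP => i j; rewrite !mxE scaler_sumr.
by apply: eq_bigr => l _; rewrite !mxE scalerAr.
Qed.

HB.instance Definition _ := GRing.Lalgebra_isAlgebra.Build R btmx btmx_scalerAr.

End Algebra.

End BlockTriangular.

Arguments btmx {R} A {m} k k_gt0.

(* Main.v *)
Require Import Defs.
From HB Require Import structures.
From mathcomp Require Import all_boot all_order all_algebra.

(** Write [C] for the block triangular algebra and [E_st a] for the matrix with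
    the single entry [a], in position [(s, t)], which must lie in a block on or
    above the diagonal.

    Since principal left ideals suffice, [psi] is LIP exactly when [psi x] is
    always in [C x].  Splitting [x = x e + x (1 - e)] along an idempotent [e] then
    gives [psi (x e) = psi x * e] ([LIP_mul_idem]), so [psi] commutes with right
    multiplication by the whole subring generated by the idempotents.  That
    subring contains every [E_st a] with [s != t], because [E_ss 1 + E_st a] is
    idempotent ([LIP_mul_square0], [LIP_mul_offdiag]).

    There remain the diagonal elements [E_ss a].  If some [t != s] has
    [E_st 1] in [C], then right multiplication by [E_st 1] moves column [s]
    injectively to column [t] and sends [E_ss a] to [E_st a], which is already
    under control; this forces [psi (E_ss a) = psi 1 * E_ss a]
    ([LIP_bunit_diag]).  Such a [t] can be found in the last block unless that
    block consists of [s] alone.  Hence [C] is SLIP when the last block has size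
    at least 2, and otherwise the only obstruction sits at the last index [z].

    For that index, the entries of column [z] of [psi (E_zz a)] are LIP functions
    of [a], so that [A] being SLIP settles the matter ([LIP_bunit_SLIP]).
    Conversely, row [z] of every matrix in [C] vanishes outside position [z], so
    an LIP map [phi] of [A] extends to the LIP map [M |-> E_zz (phi M_zz)] of [C],
    and the multiplier property descends from the extension to [phi]
    ([SLIP_of_btmx]). *)

Set Implicit Arguments.
Unset Strict Implicit.
Unset Printing Implicit Defensive.

Import GRing.Theory.

(** * LIP maps and right multiplication by idempotents *)

Section RightMultiplicativity.
Local Open Scope ring_scope.
Variables (R : pzRingType) (C : algType R).

Lemma LIP_principal (psi : C -> C) (x : C) :
  LIP psi -> exists c, psi x = c * x.
Proof.
move=> /(_ (fun y => exists c, y = c * x)); apply; last by exists 1; rewrite mul1r.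
split=> [|_ _ [c ->] [d ->]|d _ [c ->]].
- by exists 0; rewrite mul0r.
- by exists (c + d); rewrite mulrDl.
- by exists (d * c); rewrite mulrA.
Qed.

Lemma principal_LIP (psi : C -> C) :
  (forall x, exists c, psi x = c * x) -> LIP psi.
Proof. by move=> psiP J [_ _ JM] x Jx; have [c ->] := psiP x; apply: JM. Qed.

Variable psi : {linear C -> C}.
Hypothesis psiLIP : LIP psi.

(** Both [psi (x * e)] and [psi (x * (1 - e))] stay in the left ideals generated
    by their arguments, so right multiplication by [e] fixes the former and kills
    the latter. *)
Lemma LIP_mul_idem e : e * e = e -> forall x, psi (x * e) = psi x * e.
Proof.
move=> ee x; have [c psi_xe] := LIP_principal (x * e) psiLIP.
have [d psi_xe'] := LIP_principal (x * (1 - e)) psiLIP.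
have -> : psi x = psi (x * e) + psi (x * (1 - e)).
  by rewrite -linearD -mulrDr addrC subrK mulr1.
rewrite mulrDl psi_xe psi_xe' -!mulrA ee mulrBl mul1r ee subrr.
by rewrite !mulr0 addr0.
Qed.

(** The hypotheses make [e + y] idempotent, whence [y] is a difference of two
    idempotents; they are those of [e = E_ss 1] and [y = E_st a] for [s != t]. *)
Lemma LIP_mul_square0 e y : e * e = e -> e * y = y -> y * e = 0 ->
  forall x, psi (x * y) = psi x * y.
Proof.
move=> ee ey ye x; have yy : y * y = 0 by rewrite -[X in _ * X]ey mulrA ye mul0r.
have /LIP_mul_idem/(_ x) : (e + y) * (e + y) = e + y.
  by rewrite mulrDl !mulrDr ee ey ye yy !addr0.
by rewrite !mulrDr linearD LIP_mul_idem // => /addrI.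
Qed.

End RightMultiplicativity.

(** * Matrix units of the block triangular algebra *)

Section MatrixUnits.
Local Open Scope ring_scope.
Variables (R : pzRingType) (A : algType R) (m : nat) (k : 'I_m.+1 -> nat).
Variable k_gt0 : forall i, (0 < k i)%N.
Local Notation C := (btmx A k k_gt0).
Local Notation index := 'I_(\sum_i k i).
Local Notation block s := (tagnat.sig1 s).
Local Notation utrig := (@block_utrig R A m k).

Lemma block_utrig_entryP (M : 'M[A]_(\sum_i k i)) :
  reflect (forall s t : index, (block t < block s)%N -> M s t = 0)
          (M \in utrig).
Proof.
apply: (iffP (block_utrigP M)) => [M0 s t /M0/matrixP|M0 i j lt_ji].
  by move=> /(_ (tagnat.sig2 s) (tagnat.sig2 t)); rewrite !mxE !tagnat.sig2K.
by apply/matrixP => a b; rewrite !mxE M0 // !tagnat.Rank1K.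
Qed.

Definition scaled_unit (s t : index) (a : A) : 'M[A]_(\sum_i k i) :=
  \matrix_(p, q) if (p == s) && (q == t) then a else 0.

Fact scaled_unit_subproof s t a :
  (block s <= block t)%N -> scaled_unit s t a \in utrig.
Proof.
move=> le_st; apply/block_utrig_entryP => p q lt_qp; rewrite mxE.
by case: andP => // -[/eqP ps /eqP qt]; rewrite ps qt ltnNge le_st in lt_qp.
Qed.

Definition bunit s t (le_st : (block s <= block t)%N) a : C :=
  BTMx k_gt0 (scaled_unit_subproof a le_st).

Lemma bunitE s t (le_st : (block s <= block t)%N) a p q :
  bunit le_st a p q = if (p == s) && (q == t) then a else 0.
Proof. by rewrite mxE. Qed.

Lemma mul_bunitE (M : C) s t (le_st : (block s <= block t)%N) a p q :
  (M * bunit le_st a) p q = if q == t then M p s * a else 0.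
Proof.
rewrite mxE [LHS](bigD1 s) //= mxE eqxx [X in _ + X]big1 ?addr0 => [|l ls].
  by case: eqP; rewrite ?mulr0.
by rewrite mxE (negPf ls) mulr0.
Qed.

Lemma bunitM s t u (st : (block s <= block t)%N) (tu : (block t <= block u)%N)
    (su : (block s <= block u)%N) a b :
  bunit st a * bunit tu b = bunit su (a * b).
Proof.
apply/val_inj/matrixP => p q.
rewrite [LHS]mul_bunitE !mxE eqxx andbT.
by case: (q == u); case: (p == s); rewrite ?mul0r.
Qed.

Lemma bunitM0 s t t' u (st : (block s <= block t)%N)
    (tu : (block t' <= block u)%N) a b :
  t != t' -> bunit st a * bunit tu b = 0.
Proof.
move=> neq_tt'; apply/val_inj/matrixP => p q.
by rewrite [LHS]mul_bunitE !mxE (eq_sym t') (negPf neq_tt') andbF mul0r if_same.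
Qed.

Lemma btmx_sumE I (r : seq I) (P : pred I) (F : I -> C) p q :
  (\sum_(i <- r | P i) F i) p q = \sum_(i <- r | P i) F i p q.
Proof.
rewrite -[LHS]/((val : C -> 'M[A]_(\sum_i k i)) _ p q).
by rewrite (raddf_sum (val : C -> _)) summxE.
Qed.

(** Every matrix is the sum of its entries placed at their positions, so an
    identity between additive maps need only be verified on matrix units. *)
Lemma bunit_ind (P : C -> Prop) :
    P 0 -> (forall M N, P M -> P N -> P (M + N)) ->
    (forall s t (st : (block s <= block t)%N) a, P (bunit st a)) ->
  forall M, P M.
Proof.
move=> P0 PD PE M.
(* Below the diagonal blocks the entry of [M] is 0, so the default is never used
   with a wrong value. *)
pose F s t : C := insubd 0 (scaled_unit s t (M s t)).
have FE s t p q : F s t p q = if (p == s) && (q == t) then M s t else 0.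
  rewrite -[LHS]/((val : C -> 'M[A]_(\sum_i k i)) _ p q).
  rewrite val_insubd; case: ifP => [_|]; first by rewrite mxE.
  have [st|lt_ts] := leqP (block s) (block t).
    by rewrite scaled_unit_subproof.
  have /block_utrig_entryP/(_ _ _ lt_ts) -> := valP M.
  by rewrite /= mxE if_same.
suff -> : M = \sum_s \sum_t F s t.
  apply: (big_ind P) => // s _; apply: (big_ind P) => // t _.
  have [st|lt_ts] := leqP (block s) (block t).
    suff -> : F s t = bunit st (M s t) by [].
    by apply/val_inj/matrixP => p q; rewrite [LHS]FE mxE.
  suff -> : F s t = 0 by [].
  apply/val_inj/matrixP => p q; rewrite [LHS]FE mxE.
  by have /block_utrig_entryP/(_ _ _ lt_ts) -> := valP M; rewrite if_same.
apply/val_inj/matrixP => p q; rewrite [RHS]btmx_sumE.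
rewrite [RHS](eq_bigr _ (fun s _ => btmx_sumE _ _ (F s) p q)).
rewrite [RHS](bigD1 p) //= [X in _ = X + _](bigD1 q) //= FE !eqxx.
rewrite [X in _ = _ + X]big1 => [|s sp]; last first.
  by rewrite big1 // => t _; rewrite FE eq_sym (negPf sp).
rewrite addr0 [X in _ = _ + X]big1 ?addr0 // => t tq.
by rewrite FE (eq_sym q) (negPf tq) andbF.
Qed.

(** * LIP maps of the block triangular algebra *)

Section LIPBlock.
Variable psi : {linear C -> C}.
Hypothesis psiLIP : LIP psi.

Lemma LIP_mul_diag s (ss : (block s <= block s)%N) :
  forall M, psi (M * bunit ss 1) = psi M * bunit ss 1.
Proof. by apply: LIP_mul_idem => //; rewrite (bunitM _ _ ss) mulr1. Qed.

Lemma LIP_mul_offdiag s t (st : (block s <= block t)%N) a : s != t ->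
  forall M, psi (M * bunit st a) = psi M * bunit st a.
Proof.
move=> neq_st; apply: (LIP_mul_square0 psiLIP (e := bunit (leqnn (block s)) 1)) => //.
- by rewrite (bunitM _ _ (leqnn _)) mulr1.
- by rewrite (bunitM _ _ st) mul1r.
- by rewrite bunitM0 // eq_sym.
Qed.

(** [E_ss a * E_st 1 = E_st a] is off-diagonal, and right multiplication by
    [E_st 1] is injective on matrices supported in column [s], where
    [psi (E_ss a)] lives. *)
Lemma LIP_bunit_diag s t : s != t -> (block s <= block t)%N ->
  forall (ss : (block s <= block s)%N) a, psi (bunit ss a) = psi 1 * bunit ss a.
Proof.
move=> neq_st st ss a; apply/val_inj/matrixP => p q; rewrite [RHS]mul_bunitE.
have -> : psi (bunit ss a) = psi (bunit ss a) * bunit ss 1.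
  by rewrite -LIP_mul_diag // (bunitM _ _ ss) mulr1.
rewrite [LHS]mul_bunitE; case: eqP => // _; rewrite mulr1.
have : psi (bunit ss a) * bunit st 1 = psi 1 * bunit st a.
  by rewrite -!LIP_mul_offdiag // (bunitM _ _ st) mul1r mulr1.
move=> /(congr1 (fun N : C => N p t)).
by rewrite !mul_bunitE eqxx mulr1.
Qed.

(** The coordinates through which [psi] on the corner [E_zz A] is seen as a family
    of maps of [A], one for each row [p]. *)
Definition corner_coef z p (zz : (block z <= block z)%N) (a : A) : A :=
  psi (bunit zz a) p z.

Fact corner_coef_linear z p (zz : (block z <= block z)%N) :
  linear (corner_coef p zz).
Proof.
move=> r a b; rewrite /corner_coef.
have -> : bunit zz (r *: a + b) = r *: bunit zz a + bunit zz b.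
  apply/val_inj/matrixP => i j; rewrite !mxE.
  by case: ifP; rewrite ?scaler0 ?addr0.
by rewrite linearP /= !mxE.
Qed.

HB.instance Definition _ z p (zz : (block z <= block z)%N) :=
  GRing.isLinear.Build R A A _ (corner_coef p zz) (corner_coef_linear p zz).

(** [psi (E_zz a) = c * E_zz a] for some [c], hence its entry [(p, z)] is
    [c_pz * a]: each [corner_coef] is LIP, and the hypothesis on [A] applies. *)
Lemma LIP_bunit_SLIP z (zz : (block z <= block z)%N) a :
  SLIP A -> psi (bunit zz a) = psi 1 * bunit zz a.
Proof.
move=> slipA; apply/val_inj/matrixP => p q; rewrite [RHS]mul_bunitE.
have corner_LIP : LIP (corner_coef p zz).
  apply: principal_LIP => x; have [c cE] := LIP_principal (bunit zz x) psiLIP.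
  by exists (c p z); rewrite /corner_coef cE mul_bunitE eqxx.
have [->|neq_qz] := eqVneq q z; last first.
  have [c ->] := LIP_principal (bunit zz a) psiLIP.
  by rewrite [LHS]mul_bunitE (negPf neq_qz).
rewrite -[LHS]/(corner_coef p zz a) (slipA _ corner_LIP).
congr (_ * _); rewrite -[LHS]/(psi (bunit zz 1) p z).
by rewrite -(mul1r (bunit zz 1)) LIP_mul_diag mul_bunitE eqxx mulr1.
Qed.

End LIPBlock.

(** * Extending a LIP map from the last corner *)

Section CornerExtension.
Variables (z : index) (z_last : forall s : index, (block z <= block s)%N -> s = z).
Variable phi : {linear A -> A}.
Local Notation zz := (leqnn (block z)).

Definition corner_ext (M : C) : C := bunit zz (phi (M z z)).

Fact corner_ext_linear : linear corner_ext.
Proof.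
move=> r M N; apply/val_inj/matrixP => i j; rewrite !mxE linearP.
by case: ifP; rewrite ?scaler0 ?addr0.
Qed.

HB.instance Definition _ :=
  GRing.isLinear.Build R C C _ corner_ext corner_ext_linear.

(** The only entry of row [z] of [M] that can be nonzero is the diagonal one,
    since [z] is the sole index in or after its block. *)
Lemma bunit_mul_corner a (M : C) : bunit zz a * M = bunit zz (a * M z z).
Proof.
apply/val_inj/matrixP => i j; rewrite !mxE [LHS](bigD1 z) //= mxE eqxx andbT.
rewrite [X in _ + X]big1 ?addr0 => [|l lz]; last by rewrite mxE (negPf lz) andbF mul0r.
have [_|] := eqVneq i z; last by rewrite mul0r.
have [->//|neq_jz] := eqVneq j z.
have /block_utrig_entryP -> := valP M; first by rewrite mulr0.
by rewrite ltnNge; apply: contra neq_jz => /z_last->.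
Qed.

Lemma corner_ext_LIP : LIP phi -> LIP corner_ext.
Proof.
move=> phiLIP; apply: principal_LIP => M.
have [c cE] := LIP_principal (M z z) phiLIP.
by exists (bunit zz c); rewrite bunit_mul_corner /corner_ext cE.
Qed.

Lemma corner_ext_multiplier : left_multiplier corner_ext -> left_multiplier phi.
Proof.
move=> extM a; have := extM (bunit zz a); rewrite bunit_mul_corner.
move=> /(congr1 (fun N : C => N z z)).
by rewrite !bunitE !mxE !eqxx.
Qed.

End CornerExtension.

(** Each diagonal position is governed either by [A] itself or by an
    off-diagonal position in the same row. *)
Lemma btmx_SLIP :
  (forall s : index, SLIP A \/ exists2 t, s != t & (block s <= block t)%N) -> SLIP C.
Proof.
move=> diagP psi psiLIP; apply: bunit_ind => [|M N psiM psiN|s t st a].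
- by rewrite linear0 mulr0.
- by rewrite linearD psiM psiN mulrDr.
have [eq_st|neq_st] := eqVneq s t; last first.
  by rewrite -LIP_mul_offdiag // mul1r.
case: _ / eq_st st => ss.
have [slipA|[t' neq_st' st']] := diagP s; first exact: LIP_bunit_SLIP.
exact: (LIP_bunit_diag psiLIP neq_st').
Qed.

Lemma SLIP_of_btmx (z : index) :
  (forall s : index, (block z <= block s)%N -> s = z) -> SLIP C -> SLIP A.
Proof.
move=> z_last slipC phi phiLIP; apply: (corner_ext_multiplier z_last).
exact: slipC (corner_ext_LIP z_last phiLIP).
Qed.

End MatrixUnits.

(** * The SLIP property of block triangular algebras *)

Theorem theorem4p6 (R : comPzRingType) (A : algType R) (m : nat)
    (k : 'I_m.+1 -> nat) (k_gt0 : forall i : 'I_m.+1, 0 < k i) :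
  (2 <= k ord_max -> SLIP (btmx A k k_gt0)) /\
  (k ord_max = 1 -> (SLIP (btmx A k k_gt0) <-> SLIP A)).
Proof.
pose last_row (l : 'I_(k ord_max)) := @tagnat.Rank _ k ord_max l.
have le_last s l :
    @tagnat.sig1 _ k s <= tagnat.sig1 (last_row l).
  by rewrite tagnat.Rank1K -ltnS.
split=> [k_ge2|k_eq1].
  apply: btmx_SLIP => s; right.
  pose l0 := Ordinal (ltnW k_ge2); pose l1 := Ordinal k_ge2.
  have [->|neq_s0] := eqVneq s (last_row l0); last by exists (last_row l0).
  exists (last_row l1); last exact: le_last.
  by rewrite -val_eqE /= tagnat.eq_Rank eqxx.
pose z := last_row (Ordinal (k_gt0 ord_max)).
have z_last s : tagnat.sig1 z <= @tagnat.sig1 _ k s -> s = z.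
  rewrite tagnat.Rank1K => le_s; apply/val_inj; rewrite -[s in LHS]tagnat.sig2K.
  have s_max : tagnat.sig1 s = ord_max.
    by apply/val_inj/eqP; rewrite eqn_leq le_s -ltnS ltn_ord.
  move: (tagnat.sig2 s); rewrite s_max => l; congr (val (tagnat.Rank _ _)).
  by apply/val_inj => /=; case: l => -[|l] //=; rewrite k_eq1.
split=> [|slipA]; first exact: SLIP_of_btmx z_last.
by apply: btmx_SLIP => s; left.
Qed.
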